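(* Let $\mathcal{G}$ be an ample Hausdorff groupoid with compact unit space $\mathcal{G}^{(0)}$. The representation $\pi\colon \mathbb{C}F(\mathcal{G}) \to A(\mathcal{G})$, $\pi(\delta_U) = 1_U$, of the topological full group of $\mathcal{G}$ in its complex Steinberg algebra is injective if and only if one of the following holds: (1) $\mathcal{G} = \operatorname{Iso}(\mathcal{G})$ and $\mathcal{G}$ has at most one nontrivial isotropy group (that is, there is at most one $u \in \mathcal{G}^{(0)}$ with $|\mathcal{G}^u_u| > 1$); or (2) $\mathcal{G} \neq \operatorname{Iso}(\mathcal{G})$ and $|\mathcal{G} \setminus \mathcal{G}^{(0)}| < 3$.
   Context: A groupoid $\mathcal{G}$ is a small category in which every morphism is invertible, identified with its set of morphisms; all groupoids are assumed nonempty. Range and source are $r(\gamma)=\gamma\gamma^{-1}$, $s(\gamma)=\gamma^{-1}\gamma$; $\alpha\beta$ is defined if and only if $s(\alpha)=r(\beta)$; the unit space is $\mathcal{G}^{(0)}=r(\mathcal{G})=s(\mathcal{G})$. A topological groupoid is a groupoid with a topology making composition and inversion continuous. A Hausdorff groupoid is a topological groupoid whose topology is locally compact Hausdorff. It is étale if $r,s\colon\mathcal{G}\to\mathcal{G}^{(0)}$ are local homeomorphisms. A bisection is a subset $B\subseteq\mathcal{G}$ on which $r$ and $s$ are both injective. An étale groupoid is ample if its topology has a basis of compact open bisections. The isotropy group at $u\in\mathcal{G}^{(0)}$ is $\mathcal{G}^u_u=\{\gamma\in\mathcal{G} : r(\gamma)=s(\gamma)=u\}$, and it is nontrivial if it has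 more than one element; $\operatorname{Iso}(\mathcal{G})=\{\gamma\in\mathcal{G} : r(\gamma)=s(\gamma)\}$. For an ample Hausdorff groupoid $\mathcal{G}$, the complex Steinberg algebra $A(\mathcal{G})$ is the span of the characteristic functions $1_U\colon\mathcal{G}\to\mathbb{C}$ of compact open bisections $U$ of $\mathcal{G}$ (equivalently, the locally constant compactly supported functions $\mathcal{G} \to \mathbb{C}$), with convolution $(f*g)(\gamma)=\sum_{\alpha\beta=\gamma}f(\alpha)g(\beta)$ and involution $f^*(\gamma)=\overline{f(\gamma^{-1})}$. If $\mathcal{G}^{(0)}$ is compact, the topological full group $F(\mathcal{G})$ is the (discrete) group of all compact open bisections $B$ of $\mathcal{G}$ that are full, i.e. $r(B)=s(B)=\mathcal{G}^{(0)}$, with product $AB=\{\alpha\beta : \alpha\in A,\ \beta\in B,\ s(\alpha)=r(\beta)\}$ and inverse $B^{-1}=\{\gamma^{-1} : \gamma\in B\}$. The complex group ring $\mathbb{C}F(\mathcal{G})$ has basis $\{\delta_U : U\in F(\mathcal{G})\}$, and $\pi\colon\mathbb{C}F(\mathcal{G})\to A(\mathcal{G})$ is the $*$-homomorphism that is the linear extension of $\delta_U\mapsto 1_U$. *)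

(* Defs.v *)
From HB Require Import structures.
From mathcomp Require Import all_boot all_order all_algebra.
From mathcomp Require Import finmap.
From mathcomp Require Import all_classical all_reals all_analysis.
From mathcomp Require Import complex.
(* The notations of monalg clash with those of MathComp-Analysis. *)
From mathcomp Require Import -(notations) multinomials.monalg.

Set Implicit Arguments.
Unset Strict Implicit.
Unset Printing Implicit Defensive.

Import Order.TTheory GRing.Theory Num.Theory.

Local Open Scope classical_set_scope.
Local Open Scope ring_scope.

(* Arrows-only groupoids. [gmul a b] is the composite only when
   [gsrc a = grng b]; otherwise it is a junk value about which nothing is
   assumed. *)
HB.mixin Record isGroupoid G := {
  gmul : G -> G -> G;
  ginv : G -> G;
  grng : G -> G;
  gsrc : G -> G;
  groupoid_nonempty : [set: G] !=set0;
  grngE : forall a, grng a = gmul a (ginv a);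
  gsrcE : forall a, gsrc a = gmul (ginv a) a;
  ginvK : involutive ginv;
  grngM : forall a b, gsrc a = grng b -> grng (gmul a b) = grng a;
  gsrcM : forall a b, gsrc a = grng b -> gsrc (gmul a b) = gsrc b;
  gmulA : forall a b c, gsrc a = grng b -> gsrc b = grng c ->
    gmul a (gmul b c) = gmul (gmul a b) c;
  gmul_rng : forall a, gmul (grng a) a = a;
  gmul_src : forall a, gmul a (gsrc a) = a
}.

#[short(type="groupoidType")]
HB.structure Definition Groupoid := { G of isGroupoid G }.

Section GroupoidSets.
Variable G : groupoidType.
Implicit Types A B : set G.

Definition unit_space : set G := range (@grng G).

Definition isotropy_bundle : set G := [set a | grng a = gsrc a].

Definition isotropy_group (u : G) : set G := [set a | grng a = u /\ gsrc a = u].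

Definition nontrivial A := exists a b, [/\ A a, A b & a <> b].

Definition bisection B := set_inj B (@grng G) /\ set_inj B (@gsrc G).

Definition full B :=
  (@grng G) @` B = unit_space /\ (@gsrc G) @` B = unit_space.

Definition set_gmul A B : set G :=
  [set c | exists a b, [/\ A a, B b, gsrc a = grng b & c = gmul a b]].

Definition set_ginv A : set G := (@ginv G) @` A.

End GroupoidSets.

Arguments unit_space : clear implicits.
Arguments isotropy_bundle : clear implicits.

HB.mixin Record isTopologicalGroupoid G of Groupoid G & Topological G := {
  gmul_continuous : {within [set p : G * G | gsrc p.1 = grng p.2],
    continuous (fun p => gmul p.1 p.2 : G)};
  ginv_continuous : continuous (@ginv G)
}.

#[short(type="topologicalGroupoidType")]
HB.structure Definition TopologicalGroupoid :=
  { G of isTopologicalGroupoid G & Groupoid G & Topological G }.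

(* [f] is a local homeomorphism from [X] to the subspace [B] of [Y]. *)
Definition local_homeomorphism (X Y : topologicalType) (B : set Y)
    (f : X -> Y) :=
  forall x, exists (U : set X) (g : Y -> X),
    [/\ open_nbhs x U, f @` U `<=` B & open (f @` U : set (subspace B))] /\
    [/\ {within U, continuous f}, {in U, cancel f g}
      & {within f @` U, continuous g}].

Definition etale (G : topologicalGroupoidType) :=
  local_homeomorphism (unit_space G) (@grng G) /\
  local_homeomorphism (unit_space G) (@gsrc G).

Definition compact_open_bisection (G : topologicalGroupoidType) : set (set G) :=
  [set B | [/\ compact B, open B & bisection B]].

HB.mixin Record isAmpleHausdorff G of TopologicalGroupoid G := {
  groupoid_hausdorff : hausdorff_space G;
  groupoid_locally_compact : locally_compact [set: G];
  groupoid_etale : etale G;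
  groupoid_basis : basis (@compact_open_bisection G)
}.

#[short(type="ampleHausdorffGroupoidType")]
HB.structure Definition AmpleHausdorffGroupoid :=
  { G of isAmpleHausdorff G & TopologicalGroupoid G }.

Section GroupoidTheory.
Variable G : groupoidType.
Implicit Types a b c x : G.

Lemma grngV a : grng (ginv a) = gsrc a.
Proof. by rewrite grngE gsrcE ginvK. Qed.

Lemma gsrcV a : gsrc (ginv a) = grng a.
Proof. by rewrite grngE gsrcE ginvK. Qed.

Lemma grng_rng a : grng (grng a) = grng a.
Proof. by rewrite {1}(grngE a) grngM // grngV. Qed.

Lemma gsrc_rng a : gsrc (grng a) = grng a.
Proof. by rewrite {1}(grngE a) gsrcM ?gsrcV // grngV. Qed.

Lemma grng_src a : grng (gsrc a) = gsrc a.
Proof. by rewrite -grngV grng_rng. Qed.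

Lemma gsrc_src a : gsrc (gsrc a) = gsrc a.
Proof. by rewrite -(grngV a) gsrc_rng. Qed.

Lemma gmulKV a b : grng a = grng b -> gmul a (gmul (ginv a) b) = b.
Proof.
by move=> ab; rewrite gmulA ?grngV ?gsrcV // -grngE ab gmul_rng.
Qed.

Lemma gmulK a b : gsrc a = grng b -> gmul (ginv a) (gmul a b) = b.
Proof.
by move=> ab; rewrite gmulA ?gsrcV // -gsrcE ab gmul_rng.
Qed.

Lemma ginv_uniq a b : gsrc a = grng b -> gmul a b = grng a -> b = ginv a.
Proof.
by move=> ab e; rewrite -(gmulK ab) e -gsrcV gmul_src.
Qed.

Lemma ginvM a b : gsrc a = grng b -> ginv (gmul a b) = gmul (ginv b) (ginv a).
Proof.
move=> ab; have ba : gsrc (ginv b) = grng (ginv a) by rewrite gsrcV grngV.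
apply/esym/ginv_uniq; first by rewrite gsrcM // grngM // grngV.
have bba : gsrc b = grng (gmul (ginv b) (ginv a)) by rewrite grngM // grngV.
by rewrite -(gmulA _ _ _ ab bba) gmulKV ?grngV // grngM // -grngE.
Qed.

Lemma unit_rng a : unit_space G (grng a). Proof. by exists a. Qed.

Lemma unit_src a : unit_space G (gsrc a). Proof. by rewrite -grngV; exists (ginv a). Qed.

Lemma unitE a : unit_space G a -> grng a = a /\ gsrc a = a.
Proof. by case=> b _ <-; rewrite grng_rng gsrc_rng. Qed.

Lemma ginv_unit a : unit_space G a -> ginv a = a.
Proof.
move=> /unitE[ra sa].
by apply/esym/ginv_uniq; rewrite ?sa ?ra // -{1}ra gmul_rng.
Qed.

End GroupoidTheory.

Section LocalHomeo.
Variables (X Y : topologicalType) (B : set Y) (f : X -> Y).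
Hypothesis fB : local_homeomorphism B f.

Lemma local_homeomorphism_continuous : continuous f.
Proof.
move=> x; have [U [g [[[Uo Ux] _ _] [fU _ _]]]] := fB x.
by move: fU; rewrite continuous_open_subspace // => /(_ x); apply; rewrite inE.
Qed.

Lemma local_homeomorphism_open W : open W ->
  exists2 O, open O & O `&` B = f @` W.
Proof.
move=> Wo; exists (\bigcup_(O in [set O | open O /\ O `&` B `<=` f @` W]) O).
  by apply: bigcup_open => N [].
apply/seteqP; split => [y [[N [_ NB] Ny] By]|_ [x Wx <-]]; first exact: NB.
have [U [g [[[Uo Ux] UB /open_subspaceP[V1 V1o V1E]] [fU gK gU]]]] := fB x.
have [V2 V2o V2E] : exists2 V2, open V2 & V2 `&` f @` U =
    g @^-1` (W `&` U) `&` f @` U.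
  apply/open_subspaceP; move/continuousP: gU; apply; exact: openI.
have fUB : (f @` U) `&` B = f @` U by apply/setIidPl.
have fxU : (f @` U) (f x) by exists x.
have fx : (V1 `&` V2 `&` B) (f x).
  split; last exact: UB.
  split; first by have [] : (V1 `&` B) (f x) by rewrite V1E fUB.
  have : (V2 `&` f @` U) (f x); last by case.
  by rewrite V2E; split=> //=; rewrite gK ?inE.
split; last by case: fx.
exists (V1 `&` V2); last by case: fx.
split=> [|y [[V1y V2y] By]]; first exact: openI.
have yU : (f @` U) y by rewrite -fUB -V1E.
have [[Wgy Ugy] _] : (g @^-1` (W `&` U) `&` f @` U) y by rewrite -V2E.
exists (g y) => //; case: yU => z Uz <-; by rewrite gK ?inE.
Qed.

End LocalHomeo.

Section TopologicalGroupoidTheory.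
Variable G : topologicalGroupoidType.

Lemma continuous_gmul (X : topologicalType) (f g : X -> G) :
    continuous f -> continuous g -> (forall x, gsrc (f x) = grng (g x)) ->
  continuous (fun x => gmul (f x) (g x)).
Proof.
move=> fc gc fg x.
have /subspace_continuousP/(_ (f x, g x) (fg x)) h := @gmul_continuous G.
apply: (cvg_comp (fun x => (f x, g x)) (fun p => gmul p.1 p.2) _ h).
move=> P /= nP.
have : nbhs x ((fun x => (f x, g x)) @^-1`
   [set p | [set p : G * G | gsrc p.1 = grng p.2] p -> P p]).
  by apply: (cvg_pair (fc x) (gc x)).
by apply: filterS => y; apply; exact: fg.
Qed.

End TopologicalGroupoidTheory.

Section FullBisections.
Variable G : ampleHausdorffGroupoidType.
Implicit Types (A B C : set G) (a b c x : G).

Lemma grng_continuous : continuous (@grng G).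
Proof. exact: local_homeomorphism_continuous (@groupoid_etale G).1. Qed.

Lemma unit_space_open : open (unit_space G).
Proof.
rewrite openE => _ [a _ <-].
have [U [g [[[Uo Ux] _ _] [_ gK _]]]] := (@groupoid_etale G).1 (grng a).
rewrite /interior nbhsE; exists (U `&` (@grng G) @^-1` U).
  split; last by split=> //=; rewrite grng_rng.
  by apply: openI => //; apply: open_comp => // x _; exact: grng_continuous.
move=> x [Ux1 /= Ux2]; exists x => //.
by rewrite -[RHS](gK x) ?inE // -[LHS]gK ?inE // grng_rng.
Qed.

Definition full_bisection B := compact_open_bisection B /\ full B.

Let rsection B x := xget x [set a | B a /\ grng a = grng x].

Let rsectionP B x : full B ->
  B (rsection B x) /\ grng (rsection B x) = grng x.
Proof.
case=> rB _; have [a Ba ax] : ((@grng G) @` B) (grng x).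
  by rewrite rB; exact: unit_rng.
by rewrite /rsection; case: xgetP => [y -> //|/(_ a)]; case.
Qed.

Let rsection_continuous B : full_bisection B -> continuous (rsection B).
Proof.
move=> [[_ Bo [rB _]] fB]; apply/continuousP => W Wo.
have [N No NE] := local_homeomorphism_open (@groupoid_etale G).1 (openI Bo Wo).
suff -> : rsection B @^-1` W = (@grng G) @^-1` N.
  by apply: open_comp => // x _; exact: grng_continuous.
apply/seteqP; split => x /=; have [Bx rx] := rsectionP x fB.
  move=> Wx; have : (N `&` unit_space G) (grng x); last by case.
  by rewrite NE; exists (rsection B x).
move=> Nx; have : (N `&` unit_space G) (grng x) by split=> //; exact: unit_rng.
rewrite NE => -[y [By Wy] yx].
by rewrite (_ : rsection B x = y) //; apply: rB; rewrite ?inE // rx.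
Qed.

Lemma full_bisection_mul A B :
  full_bisection A -> full_bisection B -> full_bisection (set_gmul A B).
Proof.
move=> bA bB; have [[Ac Ao [rA sA]] fA] := bA; have [[Bc Bo [rB sB]] fB] := bB.
have AB_rng a b a' b' : A a -> B b -> gsrc a = grng b ->
    A a' -> B b' -> gsrc a' = grng b' ->
    grng (gmul a b) = grng (gmul a' b') -> gmul a b = gmul a' b'.
  move=> Aa Bb ab Aa' Bb' ab'; rewrite !grngM // => r.
  have aa' : a = a' by apply: rA; rewrite ?inE.
  by rewrite aa'; congr gmul; apply: rB; rewrite ?inE // -ab -ab' aa'.
have AB_src a b a' b' : A a -> B b -> gsrc a = grng b ->
    A a' -> B b' -> gsrc a' = grng b' ->
    gsrc (gmul a b) = gsrc (gmul a' b') -> gmul a b = gmul a' b'.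
  move=> Aa Bb ab Aa' Bb' ab'; rewrite !gsrcM // => r.
  have bb' : b = b' by apply: sB; rewrite ?inE.
  by rewrite bb'; congr gmul; apply: sA; rewrite ?inE // ab ab' bb'.
split; first split.
- have -> : set_gmul A B = (fun a => gmul a (rsection B (ginv a))) @` A.
    apply/seteqP; split => [_ [a [b [Aa Bb ab ->]]]|_ [a Aa <-]].
      exists a => //; congr gmul; have [Bx rx] := rsectionP (ginv a) fB.
      by apply: rB; rewrite ?inE // rx grngV.
    have [Bx rx] := rsectionP (ginv a) fB.
    by exists a, (rsection B (ginv a)); rewrite rx grngV.
  apply: continuous_compact => //; apply: continuous_subspaceT.
  apply: continuous_gmul => [x|x|x]; first exact: cvg_id.
    by apply: continuous_comp; [exact: ginv_continuous|exact: rsection_continuous].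
  by have [_ ->] := rsectionP (ginv x) fB; rewrite grngV.
- have -> : set_gmul A B = (fun x => gmul (ginv (rsection A x)) x) @^-1` B.
    apply/seteqP; split => [_ [a [b [Aa Bb ab ->]]]|x /= Bx].
      have [Ax rx] := rsectionP (gmul a b) fA.
      rewrite /= (_ : rsection A _ = a) ?gmulK //.
      by apply: rA; rewrite ?inE // rx grngM.
    have [Ax rx] := rsectionP x fA.
    exists (rsection A x), (gmul (ginv (rsection A x)) x).
    by rewrite grngM ?gsrcV // grngV gmulKV.
  apply: open_comp => // x _; apply: (continuous_gmul _ _ _) => [y|y|y].
  + by apply: continuous_comp; [exact: rsection_continuous|exact: ginv_continuous].
  + exact: cvg_id.
  + by have [_ <-] := rsectionP y fA; rewrite gsrcV.
- split=> x y; rewrite !inE => -[a [b [Aa Bb ab ->]]] [a' [b' [Aa' Bb' ab' ->]]].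
    exact: AB_rng.
  exact: AB_src.
- split; apply/seteqP; split => [_ [x _ <-]|u uU]; rewrite ?{1}/unit_space.
  + exact: unit_rng.
  + have [a Aa au] : ((@grng G) @` A) u by rewrite fA.1.
    have [b Bb ba] : ((@grng G) @` B) (gsrc a) by rewrite fB.1; exact: unit_src.
    by exists (gmul a b); [exists a, b|rewrite grngM].
  + exact: unit_src.
  + have [b Bb bu] : ((@gsrc G) @` B) u by rewrite fB.2.
    have [a Aa ab] : ((@gsrc G) @` A) (grng b) by rewrite fA.2; exact: unit_rng.
    by exists (gmul a b); [exists a, b|rewrite gsrcM].
Qed.

Lemma full_bisection_inv A : full_bisection A -> full_bisection (set_ginv A).
Proof.
move=> [[Ac Ao [rA sA]] fA]; split; first split.
- apply: continuous_compact => //; apply: continuous_subspaceT.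
  exact: ginv_continuous.
- have -> : set_ginv A = (@ginv G) @^-1` A.
    apply/seteqP; split => [_ [a Aa <-]|x Ax] /=; first by rewrite ginvK.
    by exists (ginv x) => //; rewrite ginvK.
  by apply: open_comp => // x _; exact: ginv_continuous.
- by split=> _ _ /[!inE] -[a Aa <-] [b Bb <-]; rewrite ?grngV ?gsrcV => ab;
    congr ginv; [apply: sA|apply: rA]; rewrite ?inE.
- split; rewrite image_comp; [rewrite -[RHS]fA.2|rewrite -[RHS]fA.1];
    by apply: eq_imagel => x _ /=; rewrite ?grngV ?gsrcV.
Qed.

Lemma full_bisection_unit :
  compact (unit_space G) -> full_bisection (unit_space G).
Proof.
move=> cG; split; first split => //.
- exact: unit_space_open.
- by split=> x y /[!inE] /unitE[rx sx] /unitE[ry sy]; rewrite ?rx ?ry ?sx ?sy.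
- split; apply/seteqP; split=> [_ [x _ <-]|x Ux].
  + exact: unit_rng.
  + by exists x => //; have [] := unitE Ux.
  + exact: unit_src.
  + by exists x => //; have [] := unitE Ux.
Qed.

End FullBisections.

(* [cG] is a parameter of the type so that the group structure, whose unit
   element needs it, can be inferred from the type. *)
Record topological_full_group (G : ampleHausdorffGroupoidType)
    (cG : compact (unit_space G)) := TopologicalFullGroup {
  full_group_set :> set G;
  _ : `[< full_bisection full_group_set >]
}.

Section TopologicalFullGroup.
Variables (G : ampleHausdorffGroupoidType) (cG : compact (unit_space G)).
Local Notation topological_full_group := (topological_full_group cG).
Local Notation TopologicalFullGroup := (@TopologicalFullGroup G cG).

HB.instance Definition _ := [isSub for @full_group_set G cG].
HB.instance Definition _ := [Choice of topological_full_group by <:].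

Implicit Types U V W : topological_full_group.

Lemma full_groupP U : full_bisection U.
Proof. exact/asboolP/(valP U). Qed.

Definition full_group_one :=
  TopologicalFullGroup (asboolT (full_bisection_unit cG)).

Definition full_group_mul U V := TopologicalFullGroup
  (asboolT (full_bisection_mul (full_groupP U) (full_groupP V))).

Definition full_group_inv U :=
  TopologicalFullGroup (asboolT (full_bisection_inv (full_groupP U))).

Let full_group_mulA : associative full_group_mul.
Proof.
move=> U V W; apply/val_inj/seteqP; split => x /= -[].
  move=> a [_ [Ua [b [c [Vb Wc bc ->]]] + ->]]; rewrite grngM // => ab.
  exists (gmul a b), c; rewrite gsrcM // gmulA //; split=> //.
  by exists a, b.
move=> _ [c [[a [b [Ua Vb ab ->]]] Wc + ->]]; rewrite gsrcM // => bc.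
exists a, (gmul b c); rewrite grngM // gmulA //; split=> //.
by exists b, c.
Qed.

Let full_group_mul1g : left_id full_group_one full_group_mul.
Proof.
move=> U; apply/val_inj/seteqP; split => x /=.
  by move=> [_ [b [[a _ <-] Ub + ->]]]; rewrite gsrc_rng => ->; rewrite gmul_rng.
move=> Ux; exists (grng x), x; rewrite gsrc_rng gmul_rng; split=> //.
exact: unit_rng.
Qed.

Let full_group_mulg1 : right_id full_group_one full_group_mul.
Proof.
move=> U; apply/val_inj/seteqP; split => x /=.
  by move=> [a [_ [Ua [b _ <-] + ->]]]; rewrite grng_rng => <-; rewrite gmul_src.
move=> Ux; exists x, (gsrc x); rewrite grng_src gmul_src; split=> //.
exact: unit_src.
Qed.

Let full_group_mulVg :
  left_inverse full_group_one full_group_inv full_group_mul.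
Proof.
move=> U; have [[_ _ [rU sU]] [rF sF]] := full_groupP U.
apply/val_inj/seteqP; split => x /=.
  move=> [_ [b [[a Ua <-] Ub + ->]]]; rewrite gsrcV => ab.
  rewrite (_ : b = a) -?gsrcE; first exact: unit_src.
  by apply: rU; rewrite ?inE.
rewrite -sF => -[a Ua <-]; exists (ginv a), a.
by rewrite gsrcV gsrcE; split=> //; exists a.
Qed.

Let full_group_mulgV :
  right_inverse full_group_one full_group_inv full_group_mul.
Proof.
move=> U; have [[_ _ [rU sU]] [rF sF]] := full_groupP U.
apply/val_inj/seteqP; split => x /=.
  move=> [a [_ [Ua [b Ub <-] + ->]]]; rewrite grngV => ab.
  rewrite (_ : b = a) -?grngE; first exact: unit_rng.
  by apply: sU; rewrite ?inE.
rewrite -rF => -[a Ua <-]; exists a, (ginv a).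
by rewrite grngV grngE; split=> //; exists a.
Qed.

HB.instance Definition _ := isGroup.Build topological_full_group
  full_group_mulA full_group_mul1g full_group_mulg1
  full_group_mulVg full_group_mulgV.

End TopologicalFullGroup.

Section SteinbergAlgebra.
Variables (R : realType) (G : ampleHausdorffGroupoidType).
Implicit Types f g : G -> R[i].

Definition steinberg_span : set (G -> R[i]) :=
  [set f | exists n (c : 'I_n -> R[i]) (U : 'I_n -> set G),
    (forall i, compact_open_bisection (U i)) /\
    f = \sum_(i < n) c i *: (\1_(U i) : G -> R[i])].

Definition steinberg_pred : {pred G -> R[i]} :=
  fun f => `[< steinberg_span f >].

Let steinberg_submod_closed : submod_closed steinberg_pred.
Proof.
split=> [|a f g /asboolP[n [c [U [cU ->]]]] /asboolP[m [d [V [cV ->]]]]];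
    apply/asboolP.
  exists 0%N, (fun=> 0), (fun=> set0); split; first by case.
  by rewrite big_ord0.
exists (n + m)%N.
exists (fun i : 'I_(n + m) => match fintype.split i with inl j => a * c j | inr j => d j end).
exists (fun i : 'I_(n + m) => match fintype.split i with inl j => U j | inr j => V j end).
split=> [i|]; first by case: splitP.
rewrite big_split_ord scaler_sumr; congr (_ + _); apply: eq_bigr => i _.
  by rewrite (unsplitK (inl i)) scalerA.
by rewrite (unsplitK (inr i)).
Qed.

HB.instance Definition _ :=
  GRing.isSubmodClosed.Build R[i] (G -> R[i]) steinberg_pred
    steinberg_submod_closed.

Record steinberg_algebra := SteinbergAlgebra {
  steinberg_fun :> G -> R[i];
  _ : steinberg_fun \in steinberg_pred
}.

HB.instance Definition _ := [isSub for steinberg_fun].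
HB.instance Definition _ := [Choice of steinberg_algebra by <:].
HB.instance Definition _ :=
  [SubChoice_isSubLmodule of steinberg_algebra by <:].

Lemma steinberg_indic_subproof (B : set G) : compact_open_bisection B ->
  (\1_B : G -> R[i]) \in steinberg_pred.
Proof.
move=> cB; apply/asboolP; exists 1%N, (fun=> 1), (fun=> B); split=> //.
by rewrite big_ord1 scale1r.
Qed.

Definition steinberg_indic B (cB : compact_open_bisection B) :=
  SteinbergAlgebra (steinberg_indic_subproof cB).

Definition convolution f g : G -> R[i] := fun x =>
  \sum_(p \in [set p : G * G | gsrc p.1 = grng p.2 /\ gmul p.1 p.2 = x])
    f p.1 * g p.2.

Definition involution f : G -> R[i] := fun x => (f (ginv x))^*%C.

End SteinbergAlgebra.

Section Convolution.
Variables (R : realType) (G : ampleHausdorffGroupoidType).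

Lemma convolution_sum (I J : choiceType) (r : seq I) (s : seq J)
    (c : I -> R[i]) (d : J -> R[i]) (U : I -> set G) (V : J -> set G) :
    (forall i, bisection (U i)) -> (forall j, bisection (V j)) ->
  convolution (\sum_(i <- r) c i *: (\1_(U i) : G -> R[i]))
      (\sum_(j <- s) d j *: (\1_(V j) : G -> R[i])) =
  \sum_(i <- r) \sum_(j <- s)
    (c i * d j) *: (\1_(set_gmul (U i) (V j)) : G -> R[i]).
Proof.
move=> bU bV; apply/funext => x; rewrite /convolution.
set P := [set p : G * G | _].
pose Q i j := P `&` [set p : G * G | U i p.1 /\ V j p.2].
have Q1 i j : is_subset1 (Q i j).
  move=> [a b] [a' b'] [[/= ab abx] [Ua Vb]] [[/= ab' abx'] [Ua' Vb']].
  congr pair.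
    by apply: (bU i).1; rewrite ?inE // -(grngM _ _ ab) -(grngM _ _ ab') abx abx'.
  by apply: (bV j).2; rewrite ?inE // -(gsrcM _ _ ab) -(gsrcM _ _ ab') abx abx'.
pose D := \bigcup_(i in [set` r]) \bigcup_(j in [set` s]) Q i j.
have Dfin : finite_set D.
  apply: bigcup_finite => // i _; apply: bigcup_finite => // j _.
  have [[p Qp]|/set0P/negP/negPn/eqP->//] := pselect (Q i j !=set0).
  apply: (@sub_finite_set _ _ [set p]); last exact: finite_set1.
  by move=> q Qq; exact: (Q1 i j).
have DP : D `<=` P by move=> p [i _ [j _ []]].
pose h i j (p : G * G) : R[i] := c i * d j * (\1_(U i) p.1 * \1_(V j) p.2).
rewrite (eq_fsbigr (fun p => \sum_(i <- r) \sum_(j <- s) h i j p)); last first.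
  move=> p _; rewrite !fct_sumE mulr_suml; apply: eq_bigr => i _.
  by rewrite mulr_sumr; apply: eq_bigr => j _; rewrite /h mulrACA.
have hQ i j p : P p -> ~ Q i j p -> h i j p = 0.
  move=> Pp nQ; rewrite /h !indicE.
  case: (boolP (p.1 \in U i)) => [/set_mem Up|_]; last by rewrite mul0r mulr0.
  case: (boolP (p.2 \in V j)) => [/set_mem Vp|_]; last by rewrite !mulr0.
  by case: nQ.
rewrite -(fsbig_widen _ _ _ DP); last first.
  move=> p [Pp nD] /=.
  rewrite big1_seq // => i /= ir; rewrite big1_seq // => j /= js.
  by apply: hQ => // Qp; apply: nD; exists i => //; exists j.
rewrite -(fset_setK Dfin) -fsbig_seq ?fset_uniq //.
rewrite exchange_big fct_sumE /=; apply: eq_big_seq => i ir.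
rewrite exchange_big fct_sumE /=; apply: eq_big_seq => j js.
rewrite -mulr_sumr; congr (_ * _).
have hQ' p : P p -> \1_(U i) p.1 * \1_(V j) p.2 = \1_(Q i j) p :> R[i].
  move=> Pp; rewrite !indicE -natrM mulnb.
  suff -> : (p.1 \in U i) && (p.2 \in V j) = (p \in Q i j) by [].
  apply/andP/idP => [[/set_mem Up /set_mem Vp]|/set_mem[_ [Up Vp]]].
    exact/mem_set.
  by split; exact/mem_set.
rewrite (eq_big_seq (\1_(Q i j))); last first.
  by move=> p; rewrite (in_fset_set Dfin) => /set_mem/DP; exact: hQ'.
rewrite indicE; have [xUV|xUV] := pselect (set_gmul (U i) (V j) x); last first.
  rewrite (memNset xUV) big1_seq // => -[a b] _; rewrite indicE memNset //.
  by move=> [[/= ab abx] [Ua Vb]]; apply: xUV; exists a, b.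
rewrite (mem_set xUV); case: xUV => a [b [Ua Vb ab xab]].
have Qab : Q i j (a, b) by [].
have Dab : (a, b) \in fset_set D.
  by rewrite (in_fset_set Dfin); apply/mem_set; exists i => //; exists j.
rewrite (big_fsetD1 (a, b)) //= indicE mem_set // big1_seq ?addr0 // => q /=.
rewrite in_fsetD1 => /andP[/eqP qab _]; rewrite indicE memNset // => Qq.
by apply: qab; exact: (Q1 i j).
Qed.

End Convolution.

Section FullGroupRepresentation.
Variables (R : realType) (G : ampleHausdorffGroupoidType).
Variable cG : compact (unit_space G).

(* The free vector space on [F(G)], i.e. finitely supported functions. The
   ring structure that monalg gives to [malg] does not apply: it is only for
   monoids without nontrivial invertible elements. *)
Definition full_group_ring := malg (topological_full_group cG) R[i].

HB.instance Definition _ := GRing.Lmodule.on full_group_ring.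

Implicit Types (x y : full_group_ring) (U V : topological_full_group cG).

Definition full_group_delta U : full_group_ring := mkmalgU U 1.

Definition full_group_ring_mul x y : full_group_ring :=
  \sum_(U <- msupp x) \sum_(V <- msupp y)
    mkmalgU (U * V)%g (mcoeff U x * mcoeff V y).

Definition full_group_ring_star x : full_group_ring :=
  \sum_(U <- msupp x) mkmalgU (U^-1)%g (mcoeff U x)^*%C.

Definition full_group_indic U : steinberg_algebra R G :=
  steinberg_indic R (full_groupP U).1.

Definition full_group_rep x : steinberg_algebra R G :=
  \sum_(U <- msupp x) mcoeff U x *: full_group_indic U.

Let full_group_repE (D : {fset (topological_full_group cG)}%fset) x :
    (msupp x `<=` D)%fset ->
  full_group_rep x = \sum_(U <- D) mcoeff U x *: full_group_indic U.
Proof.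
move=> xD; rewrite /full_group_rep (big_fset_incl _ xD) // => U _.
by move=> /mcoeff_outdom ->; rewrite scale0r.
Qed.

Let full_group_rep_linear : linear full_group_rep.
Proof.
move=> a x y; pose D := (msupp x `|` msupp y `|` msupp (a *: x + y))%fset.
rewrite !(@full_group_repE D); last 3 first.
- by rewrite /D -fsetUA fsetUCA fsubsetUl.
- by rewrite /D -fsetUA fsubsetUl.
- exact: fsubsetUr.
rewrite scaler_sumr -big_split; apply: eq_bigr => U _ /=.
by rewrite mcoeffD mcoeffZ scalerDl scalerA.
Qed.

HB.instance Definition _ := GRing.isLinear.Build R[i] full_group_ring
  (steinberg_algebra R G) *:%R full_group_rep full_group_rep_linear.

Let full_group_repU U (a : R[i]) :
  full_group_rep (mkmalgU U a) = a *: full_group_indic U.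
Proof.
rewrite (@full_group_repE [fset U]%fset) ?msuppU_le //.
by rewrite big_seq_fset1 mcoeffUU.
Qed.

Lemma full_group_rep_delta U :
  full_group_rep (full_group_delta U) = full_group_indic U.
Proof. by rewrite full_group_repU scale1r. Qed.

Let full_group_rep_lin : {linear full_group_ring -> steinberg_algebra R G} :=
  full_group_rep.

Let val_full_group_rep x : full_group_rep x =
  \sum_(U <- msupp x) mcoeff U x *: (\1_U : G -> R[i]) :> (G -> R[i]).
Proof.
rewrite -[LHS]/(val (full_group_rep x)) /full_group_rep raddf_sum /=.
by apply: eq_bigr.
Qed.

Lemma full_group_repM x y : full_group_rep (full_group_ring_mul x y) =
  convolution (full_group_rep x) (full_group_rep y) :> (G -> R[i]).
Proof.
rewrite (val_full_group_rep x) (val_full_group_rep y) convolution_sum; last 2 first.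
- by move=> U; have [[]] := full_groupP U.
- by move=> U; have [[]] := full_groupP U.
have -> : full_group_rep (full_group_ring_mul x y) =
    \sum_(U <- msupp x) \sum_(V <- msupp y)
      (mcoeff U x * mcoeff V y) *: full_group_indic (U * V)%g.
  rewrite (linear_sum full_group_rep_lin); apply: eq_bigr => U _.
  rewrite (linear_sum full_group_rep_lin); apply: eq_bigr => V _.
  exact: full_group_repU.
rewrite -[LHS]/(val _) raddf_sum; apply: eq_bigr => U _.
by rewrite raddf_sum.
Qed.

Lemma full_group_rep_star x : full_group_rep (full_group_ring_star x) =
  involution (full_group_rep x) :> (G -> R[i]).
Proof.
have -> : full_group_rep (full_group_ring_star x) =
    \sum_(U <- msupp x) (mcoeff U x)^*%C *: full_group_indic (U^-1)%g.
  rewrite (linear_sum full_group_rep_lin); apply: eq_bigr => U _.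
  exact: full_group_repU.
rewrite (val_full_group_rep x) -[LHS]/(val _) raddf_sum.
apply/funext => a; rewrite /involution !fct_sumE raddf_sum.
apply: eq_bigr => U _.
transitivity ((mcoeff U x)^*%C * (\1_U (ginv a))^*%C); last by rewrite -rmorphM.
congr (_ * _).
rewrite indicE rmorph_nat -[LHS]/((a \in set_ginv U)%:R).
suff -> : (a \in set_ginv U) = (ginv a \in (U : set G)) by [].
apply/idP/idP => /set_mem.
  by move=> [b Ub <-]; rewrite ginvK; exact/mem_set.
by move=> Ua; apply/mem_set; exists (ginv a) => //; rewrite ginvK.
Qed.

End FullGroupRepresentation.

(* Main.v *)
Require Import Defs.
From mathcomp Require Import all_boot all_order all_algebra.
From mathcomp Require Import finmap.
From mathcomp Require Import all_classical all_reals all_analysis.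
From mathcomp Require Import complex.
From mathcomp Require Import -(notations) multinomials.monalg.
From mathcomp Require Import zify.

(** Two finite families of full bisections that cover every arrow equally often
    have the same image, so under an injective representation they agree up to
    order ([full_group_rep_inj_perm_eq]). A full bisection is a global section of
    the source map, so the covering condition can be checked one source fiber at
    a time. Two relations of this kind obstruct injectivity.
    - If [U] and [V] move disjoint parts of the unit space, then
      [1 + UV = U + V] as sums of indicators, since over each unit one of [U],
      [V] passes through that unit and [UV] passes through the value of the
      other one. If [U] and [V] are nontrivial, the identity occurs on the left
      only, and injectivity fails ([disjoint_supports_trivial]).
    - If two arrows leave the same unit towards two further distinct units, the
      transpositions [U], [V] along small bisections around them generate a copy
      of S_3 acting on three disjoint clopen sets, and
      [1 + UV + VU = U + V + UVU] ([star_swaps_false]). This is the vanishing of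
      the alternating sum of the 3 x 3 permutation matrices.

    Every arrow that is not a unit produces a nontrivial full bisection that is
    supported near its two endpoints ([exists_full_bisection_near]). An arrow
    between distinct units has a small bisection with disjoint range and source,
    which can be swapped with its inverse. For an isotropy arrow, either a
    neighborhood contains an arrow between distinct units, which is used instead,
    or some small bisection has range equal to source and is completed by units.

    Suppose now that the representation is injective. The first relation forbids
    nonunit arrows with disjoint endpoints ([no_disjoint_arrows]), so at most one
    isotropy group is nontrivial if all arrows are isotropy. If [a] joins two
    distinct units, conjugating by [a] would turn a nonunit isotropy arrow at one
    end into one at the other end, so there is no such arrow
    ([unit_of_isotropy]). Two parallel arrows are then equal, the star relation
    excludes arrows that share exactly one endpoint with [a], and only [a] and its
    inverse remain ([nonunit_eq_or_inv]).

    Conversely, in both cases of the theorem each full bisection is determined by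
    its value over a single unit, so evaluating there isolates its coefficient
    ([full_group_rep_inj_of_witness]). *)

Set Implicit Arguments.
Unset Strict Implicit.
Unset Printing Implicit Defensive.

Import Order.TTheory GRing.Theory Num.Theory.

Local Open Scope classical_set_scope.
Local Open Scope card_scope.

(** * Relations between indicators of full bisections *)

Section Representation.
Local Open Scope ring_scope.
Variables (R : realType) (G : ampleHausdorffGroupoidType).
Variable cG : compact (unit_space G).
Local Notation F := (topological_full_group cG).
Local Notation rep := (@full_group_rep R G cG).

Lemma full_group_rep_sum_delta (Us : seq F) (x : G) :
  (rep (\sum_(U <- Us) full_group_delta R U) : G -> R[i]) x =
  (count (fun U : F => x \in (U : set G)) Us)%:R.
Proof.
elim: Us => [|U Us IH]; first by rewrite big_nil linear0.
have repD y z : rep (y + z) = rep y + rep z by exact: linearD.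
rewrite big_cons repD full_group_rep_delta /= natrD -IH.
set y := \sum_(V <- Us) _.
by transitivity ((\1_(U : set G) : G -> R[i]) x + (rep y : G -> R[i]) x).
Qed.

Lemma mcoeff_sum_delta (Us : seq F) (V : F) :
  mcoeff V (\sum_(U <- Us) full_group_delta R U) = (count_mem V Us)%:R.
Proof.
elim: Us => [|U Us IH]; first by rewrite big_nil mcoeff0.
by rewrite big_cons mcoeffD IH mcoeffU /= natrD.
Qed.

(** Equal multiplicities at every arrow mean that the two sums of basis elements
    have the same image. *)
Lemma full_group_rep_inj_perm_eq (Us Vs : seq F) : injective rep ->
    (forall x, count (fun U : F => x \in (U : set G)) Us =
               count (fun V : F => x \in (V : set G)) Vs) ->
  perm_eq Us Vs.
Proof.
move=> rep_inj UsVs; apply/allP => W _ /=; apply/eqP.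
have /rep_inj eUV : rep (\sum_(U <- Us) full_group_delta R U) =
                    rep (\sum_(V <- Vs) full_group_delta R V).
  apply/val_inj/funext => x.
  by rewrite /= !full_group_rep_sum_delta UsVs.
by apply/eqP; rewrite -(eqr_nat R[i]) -!mcoeff_sum_delta eUV.
Qed.

(** Evaluating the image of a combination at the witness of [U] returns the
    coefficient of [U]. *)
Lemma full_group_rep_inj_of_witness :
  (forall U : F, exists2 a, (U : set G) a &
     forall V : F, (V : set G) a -> V = U) ->
  injective rep.
Proof.
move=> wit; apply: raddf_inj => z z0; apply/malgP => U; rewrite mcoeff0.
have [a Ua aU] := wit U.
have [Uz|/mcoeff_outdom//] := boolP (U \in msupp z).
have : (val (rep z)) a = 0 by rewrite z0.
rewrite /full_group_rep raddf_sum fct_sumE.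
rewrite (eq_bigr (fun V => mcoeff V z * (a \in (V : set G))%:R)); last first.
  by move=> V _; rewrite -indicE.
rewrite (bigD1_seq U) //= mem_set // mulr1 big1 ?addr0 // => V VU.
rewrite memNset ?mulr0 // => /aU VU'.
by rewrite VU' eqxx in VU.
Qed.

End Representation.

(** * Full bisections as sections of the source map *)

Section Sections.
Variables (G : ampleHausdorffGroupoidType) (cG : compact (unit_space G)).
Local Notation F := (topological_full_group cG).
Implicit Types (U V : F) (a b p x : G).

Lemma full_group_at U p :
  unit_space G p -> exists2 a, (U : set G) a & gsrc a = p.
Proof.
by move=> up; have [_ [_ sU]] := full_groupP U; move: up; rewrite -sU.
Qed.

(** On a source fiber, the indicator of [U] is the indicator of one arrow; this
    reduces relations between indicators to relations between single arrows. *)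
Lemma full_group_memE U a x :
  (U : set G) a -> gsrc a = gsrc x -> (x \in (U : set G)) = (x == a).
Proof.
move=> Ua ax; have [[_ _ [_ sU]] _] := full_groupP U.
apply/idP/eqP => [xU|->]; last exact/mem_set.
by apply: sU => //; exact/mem_set.
Qed.

Lemma full_group_unit p : unit_space G p -> ((1%g : F) : set G) p.
Proof. by []. Qed.

Lemma full_group_mul_mem U V a b : (U : set G) a -> (V : set G) b ->
  gsrc a = grng b -> ((U * V)%g : set G) (gmul a b).
Proof. by move=> Ua Vb ab; exists a, b. Qed.

Lemma full_group_sub U V : (U : set G) `<=` V -> U = V.
Proof.
move=> UV; apply/val_inj/seteqP; split=> // x Vx /=.
have [a Ua ax] := full_group_at U (unit_src x).
have := full_group_memE (UV _ Ua) ax.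
by rewrite mem_set // => /esym/eqP ->.
Qed.

Lemma nonunit_of_neq a : grng a <> gsrc a -> ~ unit_space G a.
Proof. by move=> rsa /Defs.unitE[ra sa]; rewrite ra sa in rsa. Qed.

Lemma exists_nonisotropy : [set: G] <> isotropy_bundle G ->
  exists a : G, grng a <> gsrc a.
Proof.
move=> niso; apply: contrapT => none; apply: niso.
apply/esym/seteqP; split=> // x _.
by apply: contrapT => rsx; apply: none; exists x.
Qed.

Lemma full_group_neq1 U a : (U : set G) a -> ~ unit_space G a -> U <> 1%g.
Proof. by move=> Ua na U1; apply: na; rewrite U1 in Ua. Qed.

Definition supported_on (U : set G) (N : set G) :=
  forall a, U a -> ~ unit_space G a -> N (grng a) /\ N (gsrc a).

End Sections.

(** * Construction of full bisections *)

Section PartialBisections.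
Variable G : ampleHausdorffGroupoidType.
Implicit Types (a b p q x : G) (A B N M W : set G).

Lemma gsrc_continuous : continuous (@gsrc G).
Proof. exact: local_homeomorphism_continuous (@groupoid_etale G).2. Qed.

Lemma grng_clopen B : compact_open_bisection B ->
  open (@grng G @` B) /\ closed (@grng G @` B).
Proof.
move=> [Bc Bo _]; split.
  have [V Vo <-] := local_homeomorphism_open (@groupoid_etale G).1 Bo.
  by apply: openI => //; exact: unit_space_open.
apply: compact_closed; first exact: groupoid_hausdorff.
apply: continuous_compact => //; apply: continuous_subspaceT.
exact: grng_continuous.
Qed.

Lemma compact_open_bisection_inv B :
  compact_open_bisection B -> compact_open_bisection (set_ginv B).
Proof.
move=> [Bc Bo [rB sB]]; split.
- apply: continuous_compact => //; apply: continuous_subspaceT.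
  exact: ginv_continuous.
- have -> : set_ginv B = (@ginv G) @^-1` B.
    apply/seteqP; split => [_ [a Ba <-]|x Bx] /=; first by rewrite ginvK.
    by exists (ginv x) => //; rewrite ginvK.
  by apply: open_comp => // x _; exact: ginv_continuous.
- by split=> _ _ /[!inE] -[a Ba <-] [b Bb <-]; rewrite ?grngV ?gsrcV => ab;
    congr ginv; [apply: sB|apply: rB]; rewrite ?inE.
Qed.

Lemma grng_ginv B : @grng G @` set_ginv B = @gsrc G @` B.
Proof. by rewrite image_comp; apply: eq_imagel => x _ /=; rewrite grngV. Qed.

Lemma gsrc_ginv B : @gsrc G @` set_ginv B = @grng G @` B.
Proof. by rewrite image_comp; apply: eq_imagel => x _ /=; rewrite gsrcV. Qed.

Lemma compact_open_bisection_restrict B W : compact_open_bisection B ->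
  open W -> closed W -> compact_open_bisection (B `&` @gsrc G @^-1` W).
Proof.
move=> [Bc Bo [rB sB]] Wo Wc.
have preo V : open V -> open (@gsrc G @^-1` V).
  by move=> Vo; apply: open_comp => // x _; exact: gsrc_continuous.
split; last by split=> x y /set_mem[Bx _] /set_mem[By _];
  [apply: rB|apply: sB]; exact/mem_set.
  apply: compact_closedI => //; rewrite -[W]setCK -preimage_setC.
  by apply: open_closedC; apply: preo; exact: closed_openC.
by apply: openI => //; exact: preo.
Qed.

Lemma exists_small_bisection a N M :
    open N -> open M -> N (grng a) -> M (gsrc a) ->
  exists A, [/\ compact_open_bisection A, A a, @grng G @` A `<=` N
    & @gsrc G @` A `<=` M].
Proof.
move=> No Mo Na Ma; have [_ /(_ a) Gb] := @groupoid_basis G.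
have : nbhs a (@grng G @^-1` N `&` @gsrc G @^-1` M).
  by apply: filterI; [apply: grng_continuous|apply: gsrc_continuous];
    exact: open_nbhs_nbhs.
move=> /Gb[A [cA Aa] ANM]; exists A; split=> // _ [x /ANM[]] ? ? <- //.
Qed.

Definition extend_by_units B := B `|` (unit_space G `\` @grng G @` B).

(** The added units form a compact open set because the range of [B] is clopen. *)
Lemma full_bisection_extend B : compact (unit_space G) ->
  compact_open_bisection B -> @grng G @` B = @gsrc G @` B ->
  full_bisection (extend_by_units B).
Proof.
move=> cG cB rsB; have [ro rc] := grng_clopen cB.
have [Bc Bo [rB sB]] := cB.
have unitr p : unit_space G p -> grng p = p by case/Defs.unitE.
have units p : unit_space G p -> gsrc p = p by case/Defs.unitE.
split; first split.
- apply: compactU => //; rewrite setDE; apply: compact_closedI => //.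
  exact: open_closedC.
- apply: openU => //; rewrite setDE; apply: openI; first exact: unit_space_open.
  exact: closed_openC.
- split=> x y /set_mem[Bx|[ux nx]] /set_mem[By|[uy ny]].
  + by apply: rB; rewrite inE.
  + by rewrite (unitr y) // => xy; case: ny; exists x.
  + by rewrite (unitr x) // => xy; case: nx; exists y.
  + by rewrite !unitr.
  + by apply: sB; rewrite inE.
  + by rewrite (units y) // => xy; case: ny; rewrite rsB; exists x.
  + by rewrite (units x) // => xy; case: nx; rewrite rsB; exists y.
  + by rewrite !units.
- split; apply/seteqP; split=> [_ [x _ <-]|p up].
  + exact: unit_rng.
  + have [[x Bx xp]|nB] := pselect ((@grng G @` B) p).
      by exists x => //; left.
    by exists p; [right|exact: unitr].
  + exact: unit_src.
  + have [|nB] := pselect ((@grng G @` B) p).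
      by rewrite rsB => -[x Bx xp]; exists x => //; left.
    by exists p; [right|exact: units].
Qed.

(** The transposition of the source and the range of [A] along [A]; it is a full
    bisection once these two sets are disjoint. *)
Definition swap A := extend_by_units (A `|` set_ginv A).

Lemma full_bisection_swap A : compact (unit_space G) ->
  compact_open_bisection A -> @gsrc G @` A `&` @grng G @` A = set0 ->
  full_bisection (swap A).
Proof.
move=> cG cA srA; have [Ac Ao [rA sA]] := cA.
have cA' := compact_open_bisection_inv cA; have [A'c A'o [rA' sA']] := cA'.
have dis p q : (@gsrc G @` A) p -> (@grng G @` A) q -> p = q -> False.
  move=> sp + e; rewrite -e => rp.
  by have : (@gsrc G @` A `&` @grng G @` A) p by []; rewrite srA.
apply: full_bisection_extend => //; last first.
  by rewrite !image_setU grng_ginv gsrc_ginv setUC.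
split; [exact: compactU|exact: openU|split].
- move=> x y /set_mem[Ax|A'x] /set_mem[Ay|A'y] xy.
  + by apply: rA; rewrite ?inE.
  + by exfalso; apply: dis (esym xy); [rewrite -grng_ginv; exists y|exists x].
  + by exfalso; apply: dis xy; [rewrite -grng_ginv; exists x|exists y].
  + by apply: rA'; rewrite ?inE.
- move=> x y /set_mem[Ax|A'x] /set_mem[Ay|A'y] xy.
  + by apply: sA; rewrite ?inE.
  + by exfalso; apply: dis xy; [exists x|rewrite -gsrc_ginv; exists y].
  + by exfalso; apply: dis (esym xy); [exists y|rewrite -gsrc_ginv; exists x].
  + by apply: sA'; rewrite ?inE.
Qed.

(** Coincidences [p1 = p2] and [q1 = q2] are allowed, so this also separates
    points. *)
Lemma separate_pairs p1 p2 q1 q2 :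
    p1 <> q1 -> p1 <> q2 -> p2 <> q1 -> p2 <> q2 ->
  exists N M, [/\ open N, open M, N p1 /\ N p2, M q1 /\ M q2 & N `&` M = set0].
Proof.
have sep p q : p <> q ->
    exists N M, [/\ open N, open M, N p, M q & N `&` M = set0].
  move=> /eqP pq; have := @groupoid_hausdorff G; rewrite open_hausdorff.
  move=> /(_ _ _ pq)[[N M] /= [/set_mem Np /set_mem Mq] [No Mo /eqP NM]].
  by exists N, M.
have sep2 p q r : p <> q -> p <> r ->
    exists N M, [/\ open N, open M, N p, M q /\ M r & N `&` M = set0].
  move=> /sep[N1 [M1 [N1o M1o N1p M1q d1]]] /sep[N2 [M2 [N2o M2o N2p M2q d2]]].
  exists (N1 `&` N2), (M1 `|` M2).
  split; [exact: openI|exact: openU|by []|by split; [left|right]|].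
  by rewrite setIUr setIAC d1 set0I -setIA d2 setI0 setU0.
move=> d11 d12 d21 d22.
have [N1 [M1 [N1o M1o N1p [M1q M1r] d1]]] := sep2 _ _ _ d11 d12.
have [N2 [M2 [N2o M2o N2p [M2q M2r] d2]]] := sep2 _ _ _ d21 d22.
exists (N1 `|` N2), (M1 `&` M2).
split; [exact: openU|exact: openI|by split; [left|right]|by []|].
by rewrite setIUl setIA d1 set0I (setIC M1) setIA d2 set0I setU0.
Qed.

Lemma swap_unit A p :
  unit_space G p -> ~ (@grng G @` A) p -> ~ (@gsrc G @` A) p -> swap A p.
Proof.
move=> up nr ns; right; split=> //.
by rewrite image_setU grng_ginv => -[].
Qed.

End PartialBisections.

(** * The two obstructing relations *)

Section Relations.
Variables (R : realType) (G : ampleHausdorffGroupoidType).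
Variable cG : compact (unit_space G).
Local Notation F := (topological_full_group cG).
Implicit Types (U V : F) (a b p x : G) (A B N M : set G).
Hypothesis rep_inj : injective (@full_group_rep R G cG).

(** The relation is [1 + UV = U + V], the vanishing of [(1 - U)(1 - V)]. *)
Lemma disjoint_supports_trivial U V N M :
    supported_on U N -> supported_on V M -> N `&` M = set0 ->
  U = 1%g \/ V = 1%g.
Proof.
move=> UN VM NM; have dis p : N p -> M p -> False.
  by move=> Np Mp; have : (N `&` M) p by []; rewrite NM.
suff : perm_eq [:: 1%g; (U * V)%g] [:: U; V].
  move=> /perm_mem /(_ 1%g); rewrite !inE eqxx /= => /esym/orP.
  by case=> /eqP; [left|right].
apply: (full_group_rep_inj_perm_eq rep_inj) => x.
have ux := unit_src x.
have [a Ua ax] := full_group_at U ux; have [b Vb bx] := full_group_at V ux.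
rewrite /= !addn0 (full_group_memE (@full_group_unit _ cG _ ux)) ?gsrc_src //.
rewrite (full_group_memE Ua ax) (full_group_memE Vb bx).
have [ub|nb] := pselect (unit_space G b).
  have eb : b = gsrc x by have [_ <-] := Defs.unitE ub.
  have ab : gsrc a = grng b by rewrite eb grng_src.
  have := full_group_mul_mem Ua Vb ab; rewrite eb -ax gmul_src => UVa.
  by rewrite (full_group_memE UVa ax) addnC.
have [Mrb Msb] := VM _ Vb nb; rewrite bx in Msb.
have -> : a = gsrc x.
  have [/Defs.unitE[_ <-]//|na] := pselect (unit_space G a).
  by case: (dis (gsrc x)); rewrite // -ax; have [] := UN _ Ua na.
have [c Uc cb] := full_group_at U (unit_rng b).
have ec : c = grng b.
  have [/Defs.unitE[_ <-]//|nc] := pselect (unit_space G c).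
  by case: (dis (grng b)); rewrite // -cb; have [] := UN _ Uc nc.
have := full_group_mul_mem Uc Vb cb; rewrite ec gmul_rng => UVb.
by rewrite (full_group_memE UVb bx).
Qed.

(** The relation is [1 + UV + VU = U + V + UVU]. Let [b] in [A] and [c] in [B]
    have a common source [p]. Both sides consist of [p], [b] and [c] over [p], of
    [grng b], [b^-1] and [c b^-1] over [grng b], of [grng c], [c^-1] and [b c^-1]
    over [grng c], and of three times the unit over any other unit. The arrow [a]
    ensures that none of [U], [V], [UVU] is the identity. *)
Lemma star_swaps_false U V A B a : A a ->
    (U : set G) = swap A -> (V : set G) = swap B ->
    @gsrc G @` A = @gsrc G @` B ->
    (@gsrc G @` A) `&` (@grng G @` A) = set0 ->
    (@gsrc G @` A) `&` (@grng G @` B) = set0 ->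
    (@grng G @` A) `&` (@grng G @` B) = set0 ->
  False.
Proof.
move=> Aa UA VB sAB sArA sArB rArB.
have AU : A `<=` U by rewrite UA => ? ?; left; left.
have BV : B `<=` V by rewrite VB => ? ?; left; left.
have U1 := @swap_unit _ A; rewrite -UA in U1.
have V1 := @swap_unit _ B; rewrite -VB in V1.
have dis (X Y : set G) p : X `&` Y = set0 -> X p -> Y p -> False.
  by move=> XY Xp Yp; have : (X `&` Y) p by []; rewrite XY.
have sUV p : (@gsrc G @` A) p ->
    exists a b, [/\ A a, B b, gsrc a = p & gsrc b = p].
  move=> sp; have := sp; rewrite {1}sAB => -[c Bc cp]; case: sp => d Ad dp.
  by exists d, c.
have Uinv c : A c -> (U : set G) (ginv c).
  by move=> Ac; rewrite UA; left; right; exists c.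
have Vinv c : B c -> (V : set G) (ginv c).
  by move=> Bc; rewrite VB; left; right; exists c.
have Urng c : B c -> (U : set G) (grng c).
  move=> Bc; have rc : (@grng G @` B) (grng c) by exists c.
  by apply: U1; [exact: unit_rng|move/dis; apply; eauto..].
have Vrng c : A c -> (V : set G) (grng c).
  move=> Ac; have rc : (@grng G @` A) (grng c) by exists c.
  apply: V1; [exact: unit_rng|by move=> ?; apply: (dis _ _ _ rArB rc)|].
  by rewrite -sAB => ?; apply: (dis _ _ (grng c) sArA).
suff : perm_eq [:: 1%g; (U * V)%g; (V * U)%g] [:: U; V; (U * (V * U))%g].
  have [_ [c [_ Bc _ ca]]] : exists b c,
      [/\ A b, B c, gsrc b = gsrc a & gsrc c = gsrc a].
    by apply: sUV; exists a.
  have nu d : (@gsrc G @` A) (gsrc d) ->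
      (@grng G @` A) (grng d) \/ (@grng G @` B) (grng d) -> ~ unit_space G d.
    move=> sd rd /Defs.unitE[rdd sdd]; rewrite sdd in sd; rewrite rdd in rd.
    by case: rd => rd; [apply: (dis _ _ d sArA)|apply: (dis _ _ d sArB)].
  have sa : (@gsrc G @` A) (gsrc a) by exists a.
  move=> /perm_mem /(_ 1%g); rewrite !inE eqxx /= => /esym/or3P[] /eqP/esym.
  - apply: (@full_group_neq1 _ _ _ a); first exact: AU.
    by apply: nu => //; left; exists a.
  - apply: (@full_group_neq1 _ _ _ c); first exact: BV.
    by apply: nu; rewrite ?ca //; right; exists c.
  - have sr : gsrc c = grng (ginv a) by rewrite grngV.
    (* [UVU] contains the arrow [c a^-1] from [grng a] to [grng c] *)
    apply: (@full_group_neq1 _ _ _ (gmul (grng c) (gmul c (ginv a)))).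
      apply: full_group_mul_mem; first exact: Urng.
        apply: full_group_mul_mem; [exact: BV|exact: Uinv|exact: sr].
      by rewrite grngM // gsrc_rng.
    rewrite -{1}(grngM _ _ sr) gmul_rng => /Defs.unitE[rd sd].
    have : grng c = grng a.
      by rewrite -(grngM _ _ sr) rd -[LHS]sd gsrcM // gsrcV.
    by move=> rca; apply: (dis _ _ (grng a) rArB); [exists a|exists c].
apply: (full_group_rep_inj_perm_eq rep_inj) => x.
have ux := unit_src x.
rewrite /= !addn0 (full_group_memE (@full_group_unit _ cG _ ux)) ?gsrc_src //.
(* it suffices to compare the values over [gsrc x] as multisets *)
have fiber (u v uv vu uvu : G) :
  (U : set G) u -> (V : set G) v -> ((U * V)%g : set G) uv ->
  ((V * U)%g : set G) vu -> ((U * (V * U))%g : set G) uvu ->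
  [/\ gsrc u = gsrc x, gsrc v = gsrc x, gsrc uv = gsrc x, gsrc vu = gsrc x
    & gsrc uvu = gsrc x] ->
  perm_eq [:: gsrc x; uv; vu] [:: u; v; uvu] ->
  ((x == gsrc x) +
      ((x \in ((U * V)%g : set G)) + (x \in ((V * U)%g : set G))) =
   (x \in (U : set G)) +
      ((x \in (V : set G)) + (x \in ((U * (V * U))%g : set G))))%N.
  move=> Uu Vv UVuv VUvu UVUw [us vs uvs vus ws] /permP /(_ (pred1 x)) /=.
  rewrite !addn0 ![_ == x]eq_sym.
  rewrite (full_group_memE Uu us) (full_group_memE Vv vs).
  by rewrite (full_group_memE UVuv uvs) (full_group_memE VUvu vus)
    (full_group_memE UVUw ws).
have [/sUV[b [c [Ab Bc bx cx]]]|nsA] := pselect ((@gsrc G @` A) (gsrc x)).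
- have UVc : ((U * V)%g : set G) c.
    rewrite -(gmul_rng c); apply: full_group_mul_mem;
      [exact: Urng|exact: BV|exact: gsrc_rng].
  have VUb : ((V * U)%g : set G) b.
    rewrite -(gmul_rng b); apply: full_group_mul_mem;
      [exact: Vrng|exact: AU|exact: gsrc_rng].
  have UVU : ((U * (V * U))%g : set G) (gsrc x).
    rewrite -bx gsrcE; apply: full_group_mul_mem => //; [exact: Uinv|exact: gsrcV].
  apply: (fiber _ _ _ _ _ (AU _ Ab) (BV _ Bc) UVc VUb UVU); first by rewrite gsrc_src.
  by apply/permP => P /=; rewrite !addn0; lia.
have [[b Ab bx]|nrA] := pselect ((@grng G @` A) (gsrc x)).
- have [_ [c [_ Bc _ cb]]] := sUV (gsrc b) (ex_intro2 _ _ b Ab erefl).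
  have Vp : (V : set G) (gsrc x) by rewrite -bx; exact: Vrng.
  have Ui := Uinv _ Ab.
  have Vc := BV _ Bc.
  have cb' : gsrc c = grng (ginv b) by rewrite grngV.
  have UV : ((U * V)%g : set G) (ginv b).
    rewrite -(gmul_src (ginv b)) gsrcV bx.
    by apply: full_group_mul_mem; rewrite // gsrcV grng_src.
  have VU := full_group_mul_mem Vc Ui cb'.
  have UVU : ((U * (V * U))%g : set G) (gmul c (ginv b)).
    rewrite -(gmul_rng (gmul c (ginv b))) grngM //.
    by apply: full_group_mul_mem => //; [exact: Urng|rewrite gsrc_rng grngM].
  apply: (fiber _ _ _ _ _ Ui Vp UV VU UVU).
    by rewrite gsrcM // gsrcV gsrc_src bx.
  by apply/permP => P /=; rewrite !addn0; lia.
have [[c Bc cx]|nrB] := pselect ((@grng G @` B) (gsrc x)).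
- have [b [_ [Ab _ bc _]]] : exists b d,
      [/\ A b, B d, gsrc b = gsrc c & gsrc d = gsrc c].
    by apply: sUV; rewrite sAB; exists c.
  have Up : (U : set G) (gsrc x) by rewrite -cx; exact: Urng.
  have Vi := Vinv _ Bc.
  have Ub := AU _ Ab.
  have bc' : gsrc b = grng (ginv c) by rewrite grngV.
  have VU : ((V * U)%g : set G) (ginv c).
    rewrite -(gmul_src (ginv c)) gsrcV cx.
    by apply: full_group_mul_mem; rewrite // gsrcV grng_src.
  have UV := full_group_mul_mem Ub Vi bc'.
  have UVU := full_group_mul_mem Ub VU bc'.
  apply: (fiber _ _ _ _ _ Up Vi UV VU UVU).
    by rewrite gsrcM // gsrcV gsrc_src cx.
  by apply/permP => P /=; rewrite !addn0; lia.
have Up : (U : set G) (gsrc x) by apply: U1.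
have Vp : (V : set G) (gsrc x) by apply: V1; rewrite -?sAB.
have mulp (W W' : F) : (W : set G) (gsrc x) -> (W' : set G) (gsrc x) ->
    ((W * W')%g : set G) (gsrc x).
  move=> Wx Wx'; rewrite -(gmul_src (gsrc x)) gsrc_src.
  by apply: full_group_mul_mem; rewrite // gsrc_src grng_src.
have VUp := mulp _ _ Vp Up.
by apply: (fiber _ _ _ _ _ Up Vp (mulp _ _ Up Vp) VUp (mulp _ _ Up VUp));
  rewrite ?gsrc_src.
Qed.

End Relations.

(** * Arrows of a groupoid with injective representation *)

Section Necessity.
Variables (R : realType) (G : ampleHausdorffGroupoidType).
Variable cG : compact (unit_space G).
Local Notation F := (topological_full_group cG).
Implicit Types (U V : F) (a b c p q x : G) (A B N M : set G).

Lemma supported_on_extend B N : @grng G @` B `<=` N -> @gsrc G @` B `<=` N ->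
  supported_on (extend_by_units B) N.
Proof.
move=> rN sN a [Ba|[ua _] //] _; split; [apply: rN|apply: sN]; by exists a.
Qed.

(** Nothing forces a small bisection around an isotropy arrow to have its range
    equal to its source. If they differ, it contains an arrow between distinct
    units whose endpoints are still in [N], and a swap along that arrow works. *)
Lemma exists_full_bisection_near a N : ~ unit_space G a ->
    open N -> N (grng a) -> N (gsrc a) ->
  exists U : F, U <> 1%g /\ supported_on U N.
Proof.
have nonisotropic b : grng b <> gsrc b -> open N -> N (grng b) -> N (gsrc b) ->
    exists U : F, U <> 1%g /\ supported_on U N.
  move=> rsb No Nrb Nsb.
  have [N1 [M1 [N1o M1o [N1b _] [M1b _] NM]]] := separate_pairs rsb rsb rsb rsb.
  have [A [cA Ab AN AM]] := exists_small_bisection (openI No N1o) (openI No M1o)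
    (conj Nrb N1b) (conj Nsb M1b).
  have srA : @gsrc G @` A `&` @grng G @` A = set0.
    by rewrite -subset0 -NM => p [/AM[_ ?] /AN[_ ?]].
  exists (TopologicalFullGroup cG (asboolT (full_bisection_swap cG cA srA))); split.
    apply: (@full_group_neq1 _ _ _ b); first by left; left.
    exact: nonunit_of_neq.
  apply: supported_on_extend => p; rewrite image_setU ?grng_ginv ?gsrc_ginv => -[].
  + by move=> /AN[].
  + by move=> /AM[].
  + by move=> /AM[].
  + by move=> /AN[].
move=> na No Nra Nsa.
have [A [cA Aa AN AM]] := exists_small_bisection No No Nra Nsa.
have [[b [Ab rsb]]|niso] := pselect (exists b, A b /\ grng b <> gsrc b).
  by apply: (nonisotropic b) => //; [apply: AN|apply: AM]; exists b.
have rsA : @grng G @` A = @gsrc G @` A.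
  by apply: eq_imagel => b Ab; apply: contrapT => rsb; apply: niso; exists b.
exists (TopologicalFullGroup cG (asboolT (full_bisection_extend cG cA rsA))).
split; last exact: supported_on_extend.
by apply: full_group_neq1 na; left.
Qed.

Hypothesis rep_inj : injective (@full_group_rep R G cG).

Lemma no_disjoint_arrows a b : ~ unit_space G a -> ~ unit_space G b ->
    grng a <> grng b -> grng a <> gsrc b ->
    gsrc a <> grng b -> gsrc a <> gsrc b ->
  False.
Proof.
move=> na nb rr rs sr ss.
have [N [M [No Mo [Nra Nsa] [Mrb Msb] NM]]] := separate_pairs rr rs sr ss.
have [U [U1 UN]] := exists_full_bisection_near na No Nra Nsa.
have [V [V1 VM]] := exists_full_bisection_near nb Mo Mrb Msb.
by have [] := disjoint_supports_trivial rep_inj UN VM NM.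
Qed.

Lemma no_star a b : gsrc a = gsrc b ->
  grng a <> gsrc a -> grng b <> gsrc a -> grng a <> grng b -> False.
Proof.
move=> sab ra rb rab.
have ra' := nesym ra; have rb' := nesym rb.
have [S1 [N1 [S1o N1o [S1a _] [N1a _] SN]]] := separate_pairs ra' ra' ra' ra'.
have [S2 [M2 [S2o M2o [S2a _] [M2b _] SM]]] := separate_pairs rb' rb' rb' rb'.
have [N3 [M3 [N3o M3o [N3a _] [M3b _] NM]]] := separate_pairs rab rab rab rab.
have [A0 [cA0 A0a A0N A0S]] := exists_small_bisection (openI N1o N3o)
  (openI S1o S2o) (conj N1a N3a) (conj S1a S2a).
(* the star relation needs the sources of both bisections to coincide: [B] is
   chosen over the source of [A0], and [A0] is then cut down to that of [B] *)
have [W0 Wc0] := grng_clopen (compact_open_bisection_inv cA0).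
rewrite grng_ginv in W0 Wc0.
have sA0b : (@gsrc G @` A0) (gsrc b) by rewrite -sab; exists a.
have [B [cB Bb BM BS]] := exists_small_bisection (openI M2o M3o) W0
  (conj M2b M3b) sA0b.
have [W Wc] := grng_clopen (compact_open_bisection_inv cB).
rewrite grng_ginv in W Wc.
have cA := compact_open_bisection_restrict cA0 W Wc.
set A := _ `&` _ in cA.
have sAB : @gsrc G @` A = @gsrc G @` B.
  apply/seteqP; split=> [_ [c [_ ?] <-] //|p sp].
  by have [c A0c cp] := BS _ sp; exists c => //; split=> //=; rewrite cp.
have AN : @grng G @` A `<=` N1 `&` N3.
  by move=> _ [c [A0c _] <-]; apply: A0N; exists c.
have AS : @gsrc G @` A `<=` S1 `&` S2.
  by move=> _ [c [A0c _] <-]; apply: A0S; exists c.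
have sArA : @gsrc G @` A `&` @grng G @` A = set0.
  by rewrite -subset0 -SN => p [/AS[? _] /AN[? _]].
have sArB : @gsrc G @` A `&` @grng G @` B = set0.
  by rewrite -subset0 -SM => p [/AS[_ ?] /BM[? _]].
have rArB : @grng G @` A `&` @grng G @` B = set0.
  by rewrite -subset0 -NM => p [/AN[_ ?] /BM[_ ?]].
have sBrB : @gsrc G @` B `&` @grng G @` B = set0 by rewrite -sAB.
have Aa : A a by split=> //=; rewrite sab; exists b.
exact: (star_swaps_false (cG := cG) rep_inj
  (U := TopologicalFullGroup cG (asboolT (full_bisection_swap cG cA sArA)))
  (V := TopologicalFullGroup cG (asboolT (full_bisection_swap cG cB sBrB)))
  Aa erefl erefl sAB sArA sArB rArB).
Qed.

(** Suppose that [b] is not a unit. If it sits away from the endpoints of [a], then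
    [a] and [b] have disjoint endpoints. Otherwise some [c] in {[a], [a^-1]} has
    its source at [b], and [b] and [c b c^-1] have disjoint endpoints. *)
Lemma unit_of_isotropy a b : grng a <> gsrc a ->
  grng b = gsrc b -> unit_space G b.
Proof.
move=> rsa rsb; apply: contrapT => nb.
have conj_case c : grng c <> gsrc c -> gsrc c = grng b -> False.
  move=> rsc cb.
  have sbc : gsrc b = grng (ginv c) by rewrite grngV cb.
  have cbc : gsrc c = grng (gmul b (ginv c)) by rewrite grngM.
  apply: (@no_disjoint_arrows b (gmul c (gmul b (ginv c)))) => //.
  - move=> /Defs.unitE[]; rewrite grngM // => e _.
    have bc : gmul b (ginv c) = ginv c by apply: ginv_uniq.
    have : gmul (gmul b (ginv c)) c = b.
      by rewrite -gmulA ?gsrcV // -gsrcE cb rsb gmul_src.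
    by rewrite bc -gsrcE => eb; apply: nb; rewrite -eb; exact: unit_src.
  - by rewrite grngM // -cb => /esym.
  - by rewrite gsrcM // gsrcM // gsrcV -cb => /esym.
  - by rewrite grngM // -rsb -cb => /esym.
  - by rewrite gsrcM // gsrcM // gsrcV -rsb -cb => /esym.
have [ab|ab] := pselect (gsrc a = grng b); first exact: conj_case ab.
have [ab'|ab'] := pselect (grng a = grng b).
  by apply: (conj_case (ginv a)); rewrite ?grngV ?gsrcV //; exact: nesym.
by apply: (@no_disjoint_arrows a b) => //; rewrite -?rsb //; exact: nonunit_of_neq.
Qed.

(** The star relation makes the ranges equal; then [b^-1 a] is an isotropy arrow,
    hence a unit. *)
Lemma parallel_eq a b :
  gsrc a = gsrc b -> grng a <> gsrc a -> grng b <> gsrc b -> a = b.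
Proof.
move=> sab ra rb.
have rab : grng a = grng b.
  by apply: contrapT => rab; apply: (no_star sab ra _ rab); rewrite sab.
have ba : gsrc (ginv b) = grng a by rewrite gsrcV.
have : unit_space G (gmul (ginv b) a).
  by apply: (unit_of_isotropy ra); rewrite grngM // gsrcM // grngV.
move=> /Defs.unitE[_]; rewrite gsrcM // => e.
by rewrite -[LHS](gmulKV (esym rab)) -e sab gmul_src.
Qed.

(** Up to inverting [a] or both arrows, an endpoint shared by [a] and [b] is their
    common source; otherwise their endpoints are disjoint. *)
Lemma nonunit_eq_or_inv a b : grng a <> gsrc a -> ~ unit_space G b ->
  b = a \/ b = ginv a.
Proof.
move=> rsa nb; have rsa' := nesym rsa.
have rsb : grng b <> gsrc b.
  by move=> rsb; apply: nb; exact: unit_of_isotropy rsa rsb.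
have rsb' := nesym rsb.
have [ss|ss] := pselect (gsrc b = gsrc a); first by left; exact: parallel_eq.
have [sr|sr] := pselect (gsrc b = grng a).
  by right; apply: parallel_eq; rewrite ?grngV ?gsrcV.
have [rs|rs] := pselect (grng b = gsrc a).
  right; rewrite -[LHS]ginvK; congr ginv.
  by apply: parallel_eq; rewrite ?grngV ?gsrcV.
have [rr|rr] := pselect (grng b = grng a).
  left; apply: (can_inj ginvK).
  by apply: parallel_eq; rewrite ?grngV ?gsrcV.
by case: (@no_disjoint_arrows b a) => //; exact: nonunit_of_neq.
Qed.

Lemma exists_nonunit_isotropy p : nontrivial (isotropy_group p) ->
  exists a, [/\ ~ unit_space G a, grng a = p & gsrc a = p].
Proof.
move=> [a [b [[ra sa] [rb sb] ab]]].
have [/Defs.unitE[ua _]|na] := pselect (unit_space G a); last by exists a.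
exists b; split=> // /Defs.unitE[ub _].
by apply: ab; rewrite -ua -ub ra rb.
Qed.

End Necessity.

(** * Full bisections determined by one arrow *)

Section Sufficiency.
Variables (R : realType) (G : ampleHausdorffGroupoidType).
Variable cG : compact (unit_space G).
Local Notation F := (topological_full_group cG).
Implicit Types (U V : F) (a b p x : G).

(** Away from the unit [p] that carries the nontrivial isotropy group (or an
    arbitrary [p] if there is none), full bisections consist of units. *)
Lemma full_group_rep_inj_of_isotropy : [set: G] = isotropy_bundle G ->
    is_subset1 [set u : G | unit_space G u /\ nontrivial (isotropy_group u)] ->
  injective (@full_group_rep R G cG).
Proof.
move=> iso sub1; have rs a : grng a = gsrc a.
  by have : isotropy_bundle G a by rewrite -iso.
have [p up triv] : exists2 p, unit_space G p &
    forall x, gsrc x <> p -> unit_space G x.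
  have trivE q x :
      ~ nontrivial (isotropy_group q) -> gsrc x = q -> unit_space G x.
    move=> nq xq; rewrite (_ : x = gsrc x); first exact: unit_src.
    apply: contrapT => xx; apply: nq; exists x, (gsrc x).
    by split=> //; rewrite /isotropy_group /= ?rs ?gsrc_src.
  have [[p [up np]]|none] :=
      pselect (exists u, unit_space G u /\ nontrivial (isotropy_group u)).
    exists p => // x xp; apply: (@trivE (gsrc x)) => // nx.
    by apply: xp; apply: sub1; split=> //; exact: unit_src.
  have [x0 _] := @groupoid_nonempty G.
  exists (gsrc x0); first exact: unit_src.
  move=> x _; apply: (@trivE (gsrc x)) => // nx.
  by apply: none; exists (gsrc x); split=> //; exact: unit_src.
apply: full_group_rep_inj_of_witness => U.
have [a Ua ap] := full_group_at U up; exists a => // V Va.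
apply: full_group_sub => x Vx.
have [xp|xp] := pselect (gsrc x = p).
  have := full_group_memE Va (etrans ap (esym xp)).
  by rewrite mem_set // => /esym/eqP ->.
have [y Uy yx] := full_group_at U (unit_src x).
have /triv/Defs.unitE[_ uy] : gsrc y <> p by rewrite yx.
have /triv/Defs.unitE[_ ux] := xp.
by rewrite -ux -yx uy.
Qed.

(** The witness of [U] is its arrow with source [gsrc a], which is [a] or a unit.
    In the first case [U] also contains [ginv a], in the second it does not, and
    all other arrows of [U] are units. *)
Lemma full_group_rep_inj_of_arrow a : grng a <> gsrc a ->
    (forall x, unit_space G x \/ x = a \/ x = ginv a) ->
  injective (@full_group_rep R G cG).
Proof.
move=> rsa all_x; apply: full_group_rep_inj_of_witness => U.
have usa := unit_src a; have ura := unit_rng a.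
have src_inj (W : F) x y :
    (W : set G) x -> (W : set G) y -> gsrc x = gsrc y -> x = y.
  by have [[_ _ [_ sW]] _] := full_groupP W; move=> Wx Wy; apply: sW; exact/mem_set.
have rng_inj (W : F) x y :
    (W : set G) x -> (W : set G) y -> grng x = grng y -> x = y.
  by have [[_ _ [rW _]] _] := full_groupP W; move=> Wx Wy; apply: rW; exact/mem_set.
have at_src c : gsrc c = gsrc a -> c = a \/ c = gsrc a.
  case: (all_x c) => [/Defs.unitE[_ uc]|[->|->]]; first by rewrite {1}uc; right.
    by left.
  by rewrite gsrcV => /rsa.
have at_rng c : gsrc c = grng a -> c = ginv a \/ c = grng a.
  case: (all_x c) => [/Defs.unitE[_ uc]|[->|->]]; first by rewrite {1}uc; right.
    by move=> /esym/rsa.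
  by left.
have link (W : F) : (W : set G) a <-> (W : set G) (ginv a).
  split=> Wa.
    have [c Wc cr] := full_group_at W ura.
    case: (at_rng _ cr) => [<- //|ec].
    have := rng_inj _ _ _ Wc Wa; rewrite ec grng_rng => /(_ erefl) e.
    by move: rsa; rewrite -{2}e gsrc_rng.
  have [c Wc cr] := full_group_at W usa.
  case: (at_src _ cr) => [<- //|ec].
  have := rng_inj _ _ _ Wc Wa; rewrite ec grng_src grngV => /(_ erefl) e.
  by move: rsa; rewrite -(gsrcV a) -e gsrc_src.
have [c Uc cs] := full_group_at U usa; exists c => // V Vc.
have agree : (V : set G) a <-> (U : set G) a.
  case: (at_src _ cs) => ec; first by split; rewrite -ec.
  have nW (W : F) : (W : set G) c -> ~ (W : set G) a.
    move=> Wc Wa; have := src_inj _ _ _ Wc Wa cs; rewrite ec => e.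
    by move: rsa; rewrite -{1}e grng_src.
  by split=> [/nW|/nW].
apply: full_group_sub => x Vx; case: (all_x x) => [ux|[ex|ex]]; last 2 first.
- by rewrite ex in Vx *; apply/agree.
- by rewrite ex in Vx *; apply/link/agree/link.
have [_ sx] := Defs.unitE ux.
have [y Uy yx] := full_group_at U ux.
case: (all_x y) => [/Defs.unitE[_ sy]|[ey|ey]]; first by rewrite -yx sy.
- have Va : (V : set G) a by apply/agree; rewrite -ey.
  by have := src_inj _ _ _ Vx Va; rewrite sx -yx ey => /(_ erefl) ->; rewrite -ey.
- have Va : (V : set G) (ginv a) by apply/link/agree/link; rewrite -ey.
  by have := src_inj _ _ _ Vx Va; rewrite sx -yx ey => /(_ erefl) ->; rewrite -ey.
Qed.

End Sufficiency.

Theorem theorem3p2 (R : realType) (G : ampleHausdorffGroupoidType)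
    (cG : compact (unit_space G)) :
  injective (@full_group_rep R G cG) <->
  ([set: G] = isotropy_bundle G /\
     is_subset1 [set u : G | unit_space G u /\ nontrivial (isotropy_group u)]) \/
  ([set: G] <> isotropy_bundle G /\
     exists2 n : nat, (n < 3)%N & [set: G] `\` unit_space G #= `I_n).
Proof.
split=> [inj|[[iso sub1]|[niso [n n3 card_n]]]]; last 2 first.
- exact: full_group_rep_inj_of_isotropy.
- have [a rsa] := exists_nonisotropy niso.
  have rsa' : grng (ginv a) <> gsrc (ginv a) by rewrite grngV gsrcV; exact: nesym.
  apply: (full_group_rep_inj_of_arrow rsa) => x.
  apply: contrapT => /not_orP[nx /not_orP[xa xa']].
  suff : (3 <= n)%N by rewrite leqNgt n3.
  have X3 : [set` [fset x; a; ginv a]%fset] #= `I_3.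
    apply/card_eq_fsetP; rewrite -fsetUA cardfsU1 cardfs2 !inE.
    have -> : (a == ginv a) = false.
      by apply/eqP => aa; move: rsa; rewrite -grngV -aa.
    by move/eqP/negbTE: xa => ->; move/eqP/negbTE: xa' => ->.
  rewrite -card_le_II -(card_le_eql X3) -(card_le_eqr card_n).
  apply: subset_card_le => y /=; rewrite !inE => /orP[/orP[]|] /eqP ->;
    split=> //; exact: nonunit_of_neq.
- have [iso|niso] := pselect ([set: G] = isotropy_bundle G); [left|right]; split=> //.
    move=> p q [_ np] [_ nq]; apply: contrapT => pq.
    have [a [na ra sa]] := exists_nonunit_isotropy np.
    have [b [nb rb sb]] := exists_nonunit_isotropy nq.
    by apply: (no_disjoint_arrows inj na nb); rewrite ?ra ?sa ?rb ?sb.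
  have [a rsa] := exists_nonisotropy niso.
  exists 2%N => //.
  have -> : [set: G] `\` unit_space G = [set` [fset a; ginv a]%fset].
    apply/seteqP; split=> x /=.
      by case=> _ nx; rewrite !inE; case: (nonunit_eq_or_inv inj rsa nx) => ->;
        rewrite eqxx ?orbT.
    rewrite !inE => /orP[] /eqP ->; split=> // /Defs.unitE[]; rewrite ?grngV ?gsrcV => r s;
      by move: rsa; rewrite r s.
  apply/card_eq_fsetP; rewrite cardfs2.
  by case: eqP => // aa; move: rsa; rewrite -grngV -aa.
Qed.
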